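(* Let $b\in\{2,3,4\}$, and for each positive integer $n$ let $F_b(n)$ be the number of nice Friedman numbers in base $b$ lying in $[1,n]$. Then $$\lim_{n\to\infty}\frac{F_b(n)}{n}=1.$$ That is, in binary, ternary and base four the density of nice Friedman numbers is $1$.
   Context: Fix an integer base $b\ge 2$. A base-$b$ digit is an element of $\{0,1,\dots,b-1\}$. For a finite nonempty string $s=d_1d_2\cdots d_l$ of base-$b$ digits, an order-preserving calculation from the digits of $s$ is an expression obtained as follows. Split $s$ into consecutive nonempty blocks. Read each block as a nonnegative integer written in base $b$ (this is digit concatenation; leading zeros are allowed). Then combine these integers, kept in their original left-to-right order and each used exactly once, by the binary operations $x+y$, $x-y$, $x\times y$, $x/y$, $x^y$, with arbitrary parenthesization. Unary negation may also be applied to any subexpression (for example $127=-1+2^7$ in base ten). Concatenation is applied only to digits, never to results of other operations. Expressions are evaluated in the real numbers, and expressions involving an undefined operation (such as division by zero) are discarded. A positive integer $n$ is a nice Friedman number in base $b$ if $n$ is the value of some order-preserving calculation from the digits of the base-$b$ representation of $n$ (without leading zeros) in which digit concatenation is not the only operation used, i.e. at least one of the five binary operations $+,-,\times,/$, exponentiation occurs in it. *)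

(* Defs.v *)
(* Built on MathComp and MathComp-Analysis. *)
From HB Require Import structures.
From mathcomp Require Import all_boot all_order all_algebra.
From mathcomp Require Import all_classical all_reals all_analysis.

Set Implicit Arguments.
Unset Strict Implicit.
Unset Printing Implicit Defensive.

Import Order.TTheory GRing.Theory Num.Theory.
Import numFieldNormedType.Exports.

Local Open Scope ring_scope.

Inductive binop := OpAdd | OpSub | OpMul | OpDiv | OpPow.

(* [Block s] is the concatenation of the digits in s. *)
Inductive expr :=
  | Block of seq nat
  | Neg of expr
  | Bin of binop & expr & expr.

(* Most significant digit first. *)
Definition digits_value (b : nat) (s : seq nat) : nat :=
  foldl (fun a d => a * b + d)%N 0%N s.

(* For n > 0, the condition on the head also forces s to be nonempty. *)
Definition is_base_repr (b n : nat) (s : seq nat) : bool :=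
  [&& all (fun d => d < b)%N s, head 0%N s != 0%N & digits_value b s == n].

Fixpoint expr_digits (e : expr) : seq nat :=
  match e with
  | Block s => s
  | Neg e1 => expr_digits e1
  | Bin _ e1 e2 => expr_digits e1 ++ expr_digits e2
  end.

Fixpoint blocks_nonempty (e : expr) : bool :=
  match e with
  | Block s => s != [::]
  | Neg e1 => blocks_nonempty e1
  | Bin _ e1 e2 => blocks_nonempty e1 && blocks_nonempty e2
  end.

Fixpoint has_binop (e : expr) : bool :=
  match e with
  | Block _ => false
  | Neg e1 => has_binop e1
  | Bin _ _ _ => true
  end.

(* Real exponentiation on its usual domain: any exponent for a positive base,
   positive exponents for base 0 (in particular 0 ^ 0 is undefined), and
   integer exponents for a negative base. *)
Definition real_pow (R : realType) (x y : R) : option R :=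
  if 0 < x then Some (x `^ y)
  else if x == 0 then (if 0 < y then Some 0 else None)
  else if y \is a Num.int then Some (x ^ Num.floor y) else None.

Definition binop_eval (R : realType) (o : binop) (x y : R) : option R :=
  match o with
  | OpAdd => Some (x + y)
  | OpSub => Some (x - y)
  | OpMul => Some (x * y)
  | OpDiv => if y == 0 then None else Some (x / y)
  | OpPow => real_pow x y
  end.

(* [None] when some operation in the expression is undefined. *)
Fixpoint expr_eval (R : realType) (b : nat) (e : expr) : option R :=
  match e with
  | Block s => Some (digits_value b s)%:R
  | Neg e1 => omap -%R (expr_eval R b e1)
  | Bin o e1 e2 =>
      match expr_eval R b e1, expr_eval R b e2 with
      | Some x, Some y => binop_eval o x y
      | _, _ => None
      end
  end.

Definition order_preserving_calc (s : seq nat) (e : expr) : bool :=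
  blocks_nonempty e && (expr_digits e == s).

Definition nice_friedman (R : realType) (b n : nat) : Prop :=
  (0 < n)%N /\
  exists (s : seq nat) (e : expr),
    [/\ is_base_repr b n s, order_preserving_calc s e, has_binop e
      & expr_eval R b e = Some n%:R].

Definition nice_count (R : realType) (b n : nat) : nat :=
  (\sum_(1 <= m < n.+1 | `[< nice_friedman R b m >]) 1)%N.

(* Main.v *)
Require Import Defs.
From HB Require Import structures.
From mathcomp Require Import all_boot all_order all_algebra.
From mathcomp Require Import all_classical all_reals all_analysis.
From mathcomp Require Import zify ring lra.

(* A run of L digits d = b - 1 followed by a tail V of k digits turns n = x d^L V
   into ((x + 1) b^L - 1) b^k + V.  Here 1 = d/d and b = d + d/d, so n is nice as
   soon as the L digits d of the run can also produce the exponents L and k.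
   Take k = b^u, where u is the value of an expression in l digits d; producing L
   costs only a small fraction of l further digits.  A run of this kind at
   position b^u has probability b^-L, and the runs for distinct u occupy disjoint
   positions, so it suffices that the sum of b^-L over all such u diverges, i.e.
   that l digits d have substantially more than b^l values.
   These values come from iterating the maps v -> y^v + c, for y and c taken from
   finite lists of numbers expressible with few digits d.  If y has p-adic
   valuation 1 and c is small with respect to p^K, K <= v, then y^v + c determines
   c modulo p^K, then v as a p-adic valuation, then y; so all values are distinct.
   For b = 2, 3, 4 the lists can be chosen such that the sum over all maps of
   b^-(number of digits used) exceeds 1, which gives exponential growth. *)

Set Implicit Arguments.
Unset Strict Implicit.
Unset Printing Implicit Defensive.

Import Order.TTheory GRing.Theory Num.Theory.
Import numFieldNormedType.Exports.

Local Open Scope nat_scope.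

(** * Expressions in the digit b - 1 *)

Lemma digits_value_cat (b : nat) (s t : seq nat) :
  digits_value b (s ++ t) = digits_value b s * b ^ size t + digits_value b t.
Proof.
rewrite /digits_value foldl_cat; move: (foldl _ 0 s) => a.
elim/last_ind: t => [|t x IHt]; first by rewrite /= muln1 addn0.
by rewrite -!cats1 !foldl_cat /= IHt size_cat addn1 expnSr mulnDl mulnA addnA.
Qed.

Lemma digits_value_nseq_pred (b l : nat) :
  0 < b -> digits_value b (nseq l b.-1) = b ^ l - 1.
Proof.
move=> b0; elim: l => [|l IHl] //.
rewrite -addn1 nseqD digits_value_cat IHl /= /digits_value /= mul0n add0n expn1.
rewrite addn1 expnSr; have := expn_gt0 b l; rewrite b0; nia.
Qed.

(** The tail below a run has a prescribed number of digits, hence leading zeros are allowed here. *)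
Lemma fixed_length_digits (b k v : nat) : 1 < b -> v < b ^ k ->
  exists s, [/\ size s = k, all (fun d => d < b) s & digits_value b s = v].
Proof.
move=> b1; elim: k v => [|k IHk] v; first by case: v => // _; exists [::].
rewrite expnSr => vlt.
have [|s [ss sb sv]] := IHk (v %/ b); first by rewrite ltn_divLR // ltnW.
exists (s ++ [:: v %% b]); split; first by rewrite size_cat ss addn1.
  by rewrite all_cat sb /= ltn_mod ltnW.
by rewrite digits_value_cat sv /digits_value /= mul0n add0n expn1 -divn_eq.
Qed.

Lemma base_repr_exists (b n : nat) :
  1 < b -> 0 < n -> exists s, is_base_repr b n s.
Proof.
move=> b1; elim/ltn_ind: n => n IHn n0.
have [nb|bn] := ltnP n b.
  by exists [:: n]; rewrite /is_base_repr /= nb -lt0n n0 /digits_value /=.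
have [||s /and3P[sb sh /eqP sv]] := IHn (n %/ b).
- by rewrite ltn_Pdiv.
- by rewrite divn_gt0 // ltnW.
exists (s ++ [:: n %% b]); apply/and3P; split.
- by rewrite all_cat sb /= ltn_mod ltnW.
- by case: s sh {sb sv}.
- by rewrite digits_value_cat sv /digits_value /= mul0n add0n expn1 -divn_eq.
Qed.

(** All digits are equal, so only their number matters and operands may come in any order. The
    number is exact because a run has to be used up completely. *)
Definition representable (R : realType) (b l n : nat) : Prop :=
  exists e : expr, [/\ blocks_nonempty e, expr_digits e = nseq l b.-1
    & expr_eval R b e = Some (n%:R)%R].

Lemma representable_block (R : realType) (b l : nat) :
  0 < b -> 0 < l -> representable R b l (b ^ l - 1).
Proof.
move=> b0 l0; exists (Block (nseq l b.-1)); split => //=; first by case: l l0.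
by rewrite digits_value_nseq_pred.
Qed.

Lemma representableD (R : realType) (b l1 l2 n1 n2 : nat) :
  representable R b l1 n1 -> representable R b l2 n2 ->
  representable R b (l1 + l2) (n1 + n2).
Proof.
move=> [e1 [b1 d1 v1]] [e2 [b2 d2 v2]].
exists (Bin OpAdd e1 e2); split => /=; first by rewrite b1 b2.
  by rewrite d1 d2 nseqD.
by rewrite v1 v2 /= natrD.
Qed.

Lemma representableB (R : realType) (b l1 l2 n1 n2 : nat) : n2 <= n1 ->
  representable R b l1 n1 -> representable R b l2 n2 ->
  representable R b (l1 + l2) (n1 - n2).
Proof.
move=> le21 [e1 [b1 d1 v1]] [e2 [b2 d2 v2]].
exists (Bin OpSub e1 e2); split => /=; first by rewrite b1 b2.
  by rewrite d1 d2 nseqD.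
by rewrite v1 v2 /= natrB.
Qed.

Lemma representableM (R : realType) (b l1 l2 n1 n2 : nat) :
  representable R b l1 n1 -> representable R b l2 n2 ->
  representable R b (l1 + l2) (n1 * n2).
Proof.
move=> [e1 [b1 d1 v1]] [e2 [b2 d2 v2]].
exists (Bin OpMul e1 e2); split => /=; first by rewrite b1 b2.
  by rewrite d1 d2 nseqD.
by rewrite v1 v2 /= natrM.
Qed.

Lemma representable_div (R : realType) (b l1 l2 n1 n2 : nat) :
  0 < n2 -> n2 %| n1 ->
  representable R b l1 n1 -> representable R b l2 n2 ->
  representable R b (l1 + l2) (n1 %/ n2).
Proof.
move=> n20 /dvdnP[q ->] [e1 [b1 d1 v1]] [e2 [b2 d2 v2]].
have n2r : (n2%:R != 0 :> R)%R by rewrite pnatr_eq0 -lt0n.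
exists (Bin OpDiv e1 e2); split => /=; first by rewrite b1 b2.
  by rewrite d1 d2 nseqD.
by rewrite v1 v2 /= (negPf n2r) mulnK // natrM mulfK.
Qed.

Lemma real_pow_nat (R : realType) (m n : nat) : 0 < m ->
  real_pow (m%:R : R)%R (n%:R)%R = Some ((m ^ n)%:R)%R.
Proof. by move=> m0; rewrite /real_pow ltr0n m0 powR_mulrn ?ler0n// natrX. Qed.

Lemma representableX (R : realType) (b l1 l2 n1 n2 : nat) : 0 < n1 ->
  representable R b l1 n1 -> representable R b l2 n2 ->
  representable R b (l1 + l2) (n1 ^ n2).
Proof.
move=> n10 [e1 [b1 d1 v1]] [e2 [b2 d2 v2]].
exists (Bin OpPow e1 e2); split => /=; first by rewrite b1 b2.
  by rewrite d1 d2 nseqD.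
by rewrite v1 v2 /= real_pow_nat.
Qed.

Lemma representable_digit (R : realType) (b : nat) :
  1 < b -> representable R b 1 b.-1.
Proof.
by move=> b1; have := @representable_block R b 1; rewrite expn1 subn1; apply; rewrite // ltnW.
Qed.

Lemma representable1 (R : realType) (b : nat) : 1 < b -> representable R b 2 1.
Proof.
move=> b1; have d0 : 0 < b.-1 by lia.
have dr := representable_digit R b1.
by have := representable_div d0 (dvdnn _) dr dr; rewrite divnn d0.
Qed.

Lemma representable_base (R : realType) (b : nat) :
  1 < b -> representable R b 3 b.
Proof.
move=> b1.
have := representableD (representable_digit R b1) (representable1 R b1).
by rewrite addn1 prednK // ltnW.
Qed.

Lemma representable_mulnl (R : realType) (b l n q : nat) : 0 < q ->
  representable R b l n -> representable R b (q * l) (q * n).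
Proof.
move=> q0 rn; elim: q q0 => // -[|q] IHq _; first by rewrite !mul1n.
by rewrite mulSn (mulSn _ n); apply: representableD => //; apply: IHq.
Qed.

(* A block of j digits has value b ^ j - 1, which exceeds its length by D, and
   (b-1)/(b-1) has value one less than its length.  Combining these, any gap g
   between value and length is attained with about j * g / D digits. *)
Lemma representable_gap (R : realType) (b j D g : nat) :
  1 < b -> 0 < j -> D = b ^ j - 1 - j -> 0 < D ->
  let e := j * (g %/ D).+1 + 2 * (D - g %% D) in
  representable R b e (g + e).
Proof.
move=> b1 j0 DE D0 /=.
have lt_gD : g %% D < D by rewrite ltn_mod.
(* The [q] blocks overshoot the gap by [i], which the [i] copies of (b-1)/(b-1) take back. The
   successor in [q] keeps [i] positive even if D divides g. *)
set q := (g %/ D).+1; set i := D - g %% D.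
have i0 : 0 < i by rewrite subn_gt0.
have rq := representable_mulnl (isT : 0 < q) (representable_block R (ltnW b1) j0).
have ri := representable_mulnl i0 (representable1 R b1).
have := representableD rq ri; congr (representable _ _ _ _).
- by rewrite mulnC (mulnC i).
- have -> : b ^ j - 1 = D + j by lia.
  have gE := divn_eq g D.
  have : q * D = g + i by rewrite /q mulSn {2}gE /i; lia.
  rewrite mulnDr; lia.
Qed.

(* The 13 digits are spent on x + d/d, on the base d + d/d of each of the three
   powers, and on - d/d. *)
Lemma nice_of_window (R : realType) (b l e u x V : nat) :
  1 < b -> 0 < x -> V < b ^ (b ^ u) ->
  representable R b l u -> representable R b e (13 + l + e) ->
  nice_friedman R b ((x.+1 * b ^ (13 + l + e) - 1) * b ^ (b ^ u) + V).
Proof.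
move=> b1 x0 Vlt ru; set L := 13 + l + e => rL.
have LE : L = 13 + l + e by []; clearbody L.
have b0 : 0 < b by exact: ltnW.
have bL0 : 0 < b ^ L by rewrite expn_gt0 b0.
have bk0 : 0 < b ^ (b ^ u) by rewrite expn_gt0 b0.
have k0 : 0 < b ^ u by rewrite expn_gt0 b0.
have [sx /and3P[sxb sxh /eqP sxv]] := base_repr_exists b1 x0.
have [sV [sVs sVb sVv]] := fixed_length_digits b1 Vlt.
have [e1 [ne1 de1 ve1]] := representable1 R b1.
have [eb [neb deb veb]] := representable_base R b1.
have [eL [neL deL veL]] := rL.
have [eu [neu deu veu]] := ru.
split; first by nia.
exists (sx ++ nseq L b.-1 ++ sV).
(* The run is read in order as 1, b, L, 1, b, b, u, which takes 2 + 3 + e + 2 + 3 + 3 + l digits. *)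
exists (Bin OpAdd (Bin OpMul (Bin OpSub (Bin OpMul (Bin OpAdd (Block sx) e1)
  (Bin OpPow eb eL)) e1) (Bin OpPow eb (Bin OpPow eb eu))) (Block sV)).
split.
- apply/and3P; split.
  + by rewrite !all_cat sxb sVb andbT /= all_nseq ltn_predL b0 orbT.
  + by case: sx sxh {sxb sxv}.
  + rewrite !digits_value_cat digits_value_nseq_pred // sxv sVv size_cat.
    rewrite size_nseq sVs expnD; apply/eqP; nia.
- have sx0 : sx != [::] by case: sx sxh {sxb sxv}.
  have sV0 : sV != [::] by rewrite -size_eq0 sVs -lt0n.
  rewrite /order_preserving_calc /= sx0 sV0 ne1 neb neL neu /=.
  rewrite de1 deb deL deu -!catA; apply/eqP; congr (_ ++ _).
  rewrite !catA -!nseqD.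
  by rewrite (_ : 2 + 3 + e + 2 + 3 + 3 + l = L) // LE; lia.
- by [].
- rewrite /= ve1 veb veL veu /= sxv sVv !(real_pow_nat R _ b0) /=.
  congr Some; rewrite natrD natrM natrB ?muln_gt0 ?bL0 //.
  by rewrite natrM natr1.
Qed.

(** * Distinct values *)

(* The pair (a, s) encodes the offset a - s; a or s is 0, and the truncated
   subtraction never truncates, see admissible_op_shift_le. *)
Definition shift_pow (o : nat * (nat * nat)) (v : nat) : nat :=
  o.1 ^ v + o.2.1 - o.2.2.

(** Valuation exactly 1 makes v the valuation of y^v. The factors 2 keep the sum of any two offsets
    below p^K, so that congruent sums are equal. *)
Definition admissible_op (p K : nat) (o : nat * (nat * nat)) : bool :=
  [&& 1 < o.1, logn p o.1 == 1, (o.2.1 == 0) || (o.2.2 == 0),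
      2 * o.2.1 < p ^ K & 2 * o.2.2 < p ^ K].

Lemma admissible_op_dvdn (p K v : nat) (o : nat * (nat * nat)) :
  admissible_op p K o -> K <= v -> p ^ K %| o.1 ^ v.
Proof.
case/and5P=> y1 /eqP lp _ _ _ Kv.
have py : p %| o.1 by have := pfactor_dvdnn p o.1; rewrite lp expn1.
exact: dvdn_trans (dvdn_exp2l p Kv) (dvdn_exp2r v py).
Qed.

Lemma admissible_op_shift_le (p K v : nat) (o : nat * (nat * nat)) :
  admissible_op p K o -> K <= v -> o.2.2 <= o.1 ^ v.
Proof.
move=> ao Kv; have dv := admissible_op_dvdn ao Kv.
case/and5P: ao => y1 _ _ _ sK.
have := dvdn_leq _ dv; rewrite expn_gt0 ltnW //= => /(_ isT); lia.
Qed.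

(* The offset is recovered modulo p ^ K, then v as a p-adic valuation. *)
Lemma shift_pow_inj (p K v1 v2 : nat) (o1 o2 : nat * (nat * nat)) :
  0 < K -> admissible_op p K o1 -> admissible_op p K o2 -> K <= v1 -> K <= v2 ->
  shift_pow o1 v1 = shift_pow o2 v2 -> o1 = o2 /\ v1 = v2.
Proof.
move=> K0 ao1 ao2 Kv1 Kv2; rewrite /shift_pow => E.
have dv1 := admissible_op_dvdn ao1 Kv1; have dv2 := admissible_op_dvdn ao2 Kv2.
have s1 := admissible_op_shift_le ao1 Kv1.
have s2 := admissible_op_shift_le ao2 Kv2.
case: o1 o2 ao1 ao2 E dv1 dv2 s1 s2 => [y1 [a1 t1]] [y2 [a2 t2]] /=.
move=> /and5P[/= y1gt /eqP l1 z1 a1K t1K] /and5P[/= y2gt /eqP l2 z2 a2K t2K].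
move=> E dv1 dv2 s1 s2.
(* Neither side truncates, so the subtracted parts may be moved across. *)
have E' : y1 ^ v1 + (a1 + t2) = y2 ^ v2 + (a2 + t1) by lia.
have off : a1 + t2 = a2 + t1.
  have := congr1 (fun n => n %% p ^ K) E'.
  rewrite -modnDml -[RHS]modnDml (eqP dv1) (eqP dv2) !add0n.
  by rewrite !modn_small //; lia.
have pows : y1 ^ v1 = y2 ^ v2 by lia.
have vE : v1 = v2.
  by have := congr1 (logn p) pows; rewrite !lognX l1 l2 !muln1.
have yE : y1 = y2.
  have v2gt0 : 0 < v2 by exact: leq_trans Kv2.
  by apply/eqP; rewrite -(eqn_exp2r _ _ v2gt0) -pows vE.
have [-> ->] : a1 = a2 /\ t1 = t2 by lia.
by rewrite yE vE.
Qed.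

Lemma sqr_le_exp2 (n : nat) : n * n <= 2 ^ n.+1.
Proof.
elim: n => // n IHn; rewrite expnS.
have [n2|n3] := leqP n 2; first by case: n n2 {IHn} => [|[|[|]]].
nia.
Qed.

(** Serves wherever a power must dominate a linear quantity: growth under a map, the block length,
    and the room for a window. *)
Lemma mul_le_exp2 (q n : nat) : 2 * q <= n -> q * n <= 2 ^ n.
Proof. by move=> qn; have := sqr_le_exp2 n; rewrite expnS; nia. Qed.

Definition step (o : nat * (nat * nat) * nat) (w : nat * nat) : nat * nat :=
  (shift_pow o.1 w.1, o.2 + w.2).

(* A map comes with the number of digits it uses, and a value v with the number
   of digits of an expression for v. *)
Fixpoint iterates (ops : seq (nat * (nat * nat) * nat)) (w0 : nat * nat)
    (m : nat) : seq (nat * nat) :=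
  if m is m'.+1 then [seq step o w | o <- ops, w <- iterates ops w0 m']
  else [:: w0].

Lemma shift_pow_grows (q v c : nat) (o : nat * (nat * nat)) :
  1 < o.1 -> 0 < v -> c + o.2.2 < q -> q * v <= 2 ^ v ->
  v + c <= shift_pow o v.
Proof.
case: o => y [a s] /= y1 v0 cq qv; rewrite /shift_pow /=.
have : 2 ^ v <= y ^ v by rewrite leq_exp2r.
have : q * v >= v + c + s by nia.
lia.
Qed.

(** Three invariants: values stay above all thresholds, the digit count never exceeds the value (so
    that windows fit), and each map costs at most [C] digits (so that weights can be bounded). *)
Lemma iterates_bounds (ops : seq (nat * (nat * nat) * nat)) (v0 l0 q C m : nat) :
  0 < v0 -> l0 <= v0 -> (forall v, v0 <= v -> q * v <= 2 ^ v) ->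
  (forall o, o \in ops -> [&& 1 < o.1.1, o.2 + o.1.2.2 < q & o.2 <= C]) ->
  forall w, w \in iterates ops (v0, l0) m ->
  [/\ v0 <= w.1, w.2 <= w.1 & w.2 <= l0 + m * C].
Proof.
move=> v00 lv0 big ok; elim: m => [|m IHm] w.
  by rewrite inE => /eqP ->; rewrite /= leqnn addn0.
move=> /= /allpairsP[[op w'] [/= oin win ->]] /=.
have [v1 l1 l2] := IHm _ win; have /and3P[g1 g2 g3] := ok _ oin.
have := shift_pow_grows g1 (leq_trans v00 v1) g2 (big _ v1).
move=> grow; split.
- exact: leq_trans v1 (leq_trans (leq_addr _ _) grow).
- by rewrite addnC (leq_trans _ grow) // leq_add2r.
- by rewrite mulSn addnCA leq_add.
Qed.

(** Distinct words of maps give distinct values, by [shift_pow_inj] at each letter. Costs are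
    dropped in the hypothesis, since one map listed with two costs would produce a value twice. *)
Lemma iterates_uniq (p K : nat) (ops : seq (nat * (nat * nat) * nat))
    (w0 : nat * nat) (m : nat) :
  0 < K -> uniq [seq o.1 | o <- ops] ->
  (forall o, o \in ops -> admissible_op p K o.1) ->
  (forall k w, w \in iterates ops w0 k -> K <= w.1) ->
  uniq [seq w.1 | w <- iterates ops w0 m].
Proof.
move=> K0 uops ok Kle; elim: m => [|m IHm] //=.
rewrite map_allpairs.
have -> : [seq (step o w).1 | o <- ops, w <- iterates ops w0 m] =
  [seq shift_pow o v | o <- [seq o.1 | o <- ops],
    v <- [seq w.1 | w <- iterates ops w0 m]].
  by rewrite allpairs_mapl allpairs_mapr.
apply: allpairs_uniq => // -[y1 v1] [y2 v2] /allpairsP[[x y] [/= xin yin [-> ->]]].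
move=> /allpairsP[[x' y'] [/= xin' yin' [-> ->]]] /= E.
move/mapP: xin => [t tin ->] in E *; move/mapP: xin' => [t' tin' ->] in E *.
move/mapP: yin => [u uin ->] in E *; move/mapP: yin' => [u' uin' ->] in E *.
by have [-> ->] := shift_pow_inj K0 (ok _ tin) (ok _ tin') (Kle _ _ uin)
  (Kle _ _ uin') E.
Qed.

Lemma iterates_representable (R : realType) (b : nat)
    (ops : seq (nat * (nat * nat) * nat)) (v0 l0 m : nat) :
  (forall o l v, o \in ops -> v0 <= v -> representable R b l v ->
     representable R b (o.2 + l) (shift_pow o.1 v)) ->
  (forall k w, w \in iterates ops (v0, l0) k -> v0 <= w.1) ->
  representable R b l0 v0 ->
  forall w, w \in iterates ops (v0, l0) m -> representable R b w.2 w.1.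
Proof.
move=> ok lev r0; elim: m => [|m IHm] w; first by rewrite inE => /eqP ->.
move=> /= /allpairsP[[op w'] [/= oin win ->]] /=.
by apply: ok => //; [exact: lev win | exact: IHm].
Qed.

(** Digit counts add up along a word, so the weight is multiplicative and the sum over all words of
    length m factors. *)
Lemma iterates_weight (F : fieldType) (z : F)
    (ops : seq (nat * (nat * nat) * nat)) (w0 : nat * nat) (m : nat) :
  (\sum_(w <- iterates ops w0 m) z ^+ w.2 =
   (\sum_(o <- ops) z ^+ o.2) ^+ m * z ^+ w0.2)%R.
Proof.
elim: m => [|m IHm] /=; first by rewrite big_seq1 mul1r.
rewrite big_allpairs_dep exprS -mulrA -IHm mulr_suml; apply: eq_bigr => o _.
by rewrite mulr_sumr; apply: eq_bigr => w _; rewrite exprD.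
Qed.

(** * Divergence *)

Lemma bernoulli_ge (R : realFieldType) (x : R) (n : nat) : (0 <= x)%R ->
  (1 + n%:R * x <= (1 + x) ^+ n)%R.
Proof.
move=> x0; elim: n => [|n IHn]; first by rewrite mul0r addr0 expr0.
rewrite exprS; have x1 : (0 <= 1 + x)%R by lra.
apply: le_trans (ler_wpM2l x1 IHn).
have : (0 <= n%:R * x * x :> R)%R by rewrite !mulr_ge0.
rewrite -natr1; lra.
Qed.

(* The geometric growth of the weights beats any overhead of a bounded number
   of digits per D letters, provided that D is large compared with j. *)
Lemma weight_growth (R : realFieldType) (b C j D : nat) (a : R) :
  1 < b -> 0 < j -> j * (2 * b ^ (2 * C)) <= D ->
  (1 + (b ^ C)%:R^-1 <= a)%R -> (2 * (b ^ (j * C))%:R <= a ^+ D)%R.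
Proof.
move=> b1 j0 jD aC; set q := 2 * b ^ (2 * C) in jD.
have bC0 : (0 < (b ^ C)%:R :> R)%R by rewrite ltr0n expn_gt0 ltnW.
have a1 : (1 <= a)%R.
  by apply: le_trans aC; rewrite lerDl invr_ge0 ltW.
(* Bernoulli with exponent q = 2 b^(2C) gives 1 + q / b^C = 1 + 2 b^C. *)
have aq : (2 * (b ^ C)%:R <= a ^+ q)%R.
  have h : (1 + (b ^ C)%:R^-1 : R)%R \is Num.nneg by rewrite nnegrE addr_ge0 // invr_ge0 ltW.
  apply: le_trans (lerXn2r _ h _ aC); last by rewrite nnegrE; lra.
  apply: le_trans (bernoulli_ge _ _); last by rewrite invr_ge0 ltW.
  rewrite /q (mul2n C) -addnn expnD !natrM -!mulrA mulfV ?mulr1; last by rewrite gt_eqF.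
  lra.
apply: (@le_trans _ _ (a ^+ (q * j))%R); last by apply: ler_weXn2l => //; rewrite mulnC.
rewrite exprM; apply: le_trans (lerXn2r _ _ _ aq); rewrite ?nnegrE ?mulr_ge0//; last first.
  by rewrite exprn_ge0 // (le_trans _ a1).
rewrite exprMn -(natrX _ (b ^ C)) -expnM (mulnC C) ler_wpM2r // -[leLHS]expr1.
by rewrite ler_weXn2l // ler1n.
Qed.

(** Producing an exponent costs about j / D of its gap in digits, and b^j outgrows any multiple of
    j. For j = 2(q + 3) one has (q + 3) j <= 2^j, which leaves enough after subtracting 1 + j. *)
Lemma exists_block_length (q : nat) : exists j, 
  [/\ 0 < j & forall b, 1 < b -> 0 < b ^ j - 1 - j /\ j * q <= b ^ j - 1 - j].
Proof.
exists (2 * q.+3); split=> // b b1.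
have := mul_le_exp2 (leqnn (2 * q.+3)).
have : 2 ^ (2 * q.+3) <= b ^ (2 * q.+3) by rewrite leq_exp2r.
move: (b ^ _) (2 ^ _) => x y; nia.
Qed.

Definition nice_window (R : realType) (b u L : nat) : Prop :=
  forall x V, 0 < x -> V < b ^ (b ^ u) ->
    nice_friedman R b ((x.+1 * b ^ L - 1) * b ^ (b ^ u) + V).

(** The solution of L = 13 + l + e in which e is the digit count that [representable_gap] needs for
    the gap 13 + l, so that the run can express its own length. *)
Definition window_length (j D l : nat) : nat :=
  13 + l + (j * ((13 + l) %/ D).+1 + 2 * (D - (13 + l) %% D)).

(** A crude slope suffices for keeping windows at distinct positions disjoint. *)
Lemma window_length_linear (j D l : nat) :
  window_length j D l <= (13 + 14 * j + 2 * D) + j.+1 * l.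
Proof.
rewrite /window_length; have := leq_div (13 + l) D; have := leq_subr ((13 + l) %% D) D.
move: (_ %/ _) (_ - _) => x y; nia.
Qed.

(** For divergence the slope in l must be 1. The remaining overhead is a constant plus j * C digits
    for each group of D letters. *)
Lemma window_length_le (j D l0 r C l : nat) : 0 < D -> l <= l0 + r * D * C ->
  window_length j D l <=
    l + (13 + j * ((13 + l0) %/ D).+1 + 2 * D) + r * (j * C).
Proof.
move=> D0 lle; rewrite /window_length.
have : (13 + l) %/ D <= r * C + (13 + l0) %/ D.
  rewrite -divnMDl //; apply: leq_div2r.
  have : r * D * C = r * C * D by rewrite mulnAC.
  lia.
have := leq_subr ((13 + l) %% D) D.
move: (_ %/ _) (_ - _) (_ %/ _) => z y x yD xz.
have : j * x.+1 <= j * (r * C + z).+1 by rewrite leq_mul2l ltnS xz orbT.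
have -> : j * (r * C + z).+1 = r * (j * C) + j * z.+1 by ring.
lia.
Qed.

(** The windows come from words of r * D maps. Each group of D letters contributes [a ^+ D], at
    least 2 b^(jC), against an overhead of jC digits, so the total weight is at least a constant
    times 2^r. The inequality on [ops] says that the sum of b^-cost exceeds 1, cleared of
    denominators. *)
Lemma nice_windows (R : realType) (b p K C : nat)
    (ops : seq (nat * (nat * nat) * nat)) (A : R) :
  1 < b -> 0 < K -> uniq [seq o.1 | o <- ops] ->
  all (fun o => admissible_op p K o.1 && (o.2 <= C)) ops ->
  (forall o l v, o \in ops -> K <= v -> representable R b l v ->
     representable R b (o.2 + l) (shift_pow o.1 v)) ->
  b ^ C < \sum_(o <- ops) b ^ (C - o.2) ->
  exists s : seq (nat * nat),
    [/\ uniq [seq w.1 | w <- s],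
        forall w : nat * nat, w \in s -> w.2 <= b ^ w.1 /\ nice_window R b w.1 w.2
      & (A <= \sum_(w <- s) (b%:R^-1) ^+ w.2)%R].
Proof.
move=> b1 K0 uops /allP ok rep wt.
have b0 : 0 < b by exact: ltnW.
have [j [j0 /(_ b b1)]] := exists_block_length (2 * b ^ (2 * C)).
set D := b ^ j - 1 - j => -[D0 jD].
pose c1 := 14 + 15 * j + 2 * D.
pose q := C + p ^ K + 1.
(* Since [v0] is at least [l0], it exceeds [K] and twice each of the factors [c1] and [q] to which
   [mul_le_exp2] is applied. *)
pose l0 := 2 * c1 + 2 * q + K + 1.
pose v0 := b ^ l0 - 1.
have l0v0 : l0 <= v0 by have := ltn_expl l0 b1; rewrite /v0; lia.
have v00 : 0 < v0 by apply: leq_trans l0v0; rewrite /l0; lia.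
have Kv0 : K <= v0 by apply: leq_trans l0v0; rewrite /l0; lia.
have c1v0 : 2 * c1 <= v0 by apply: leq_trans l0v0; rewrite /l0; lia.
have qv0 : 2 * q <= v0 by apply: leq_trans l0v0; rewrite /l0; lia.
have r0 : representable R b l0 v0.
  by apply: representable_block => //; rewrite /l0; lia.
have okop (o : nat * (nat * nat) * nat) :
    o \in ops -> [&& 1 < o.1.1, o.2 + o.1.2.2 < q & o.2 <= C].
  by move=> /ok /andP[/and5P[-> _ _ _ h] h']; rewrite h' /= andbT /q; lia.
have bnd m := iterates_bounds v00 l0v0
  (fun v h => mul_le_exp2 (leq_trans qv0 h)) okop (m := m).
have lev0 k w : w \in iterates ops (v0, l0) k -> v0 <= w.1 by case/bnd.
have repr m w := iterates_representable (m := m) (w := w)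
  (fun o l v oin vle => rep o l v oin (leq_trans Kv0 vle)) lev0 r0.
have uni m : uniq [seq w.1 | w <- iterates ops (v0, l0) m].
  apply: (@iterates_uniq p K _ _ _ K0 uops); first by move=> op /ok/andP[].
  by move=> k w /lev0; apply: leq_trans.
pose z : R := (b%:R^-1)%R.
have bR0 : (0 < b%:R :> R)%R by rewrite ltr0n.
have z0 : (0 < z)%R by rewrite invr_gt0.
have z1 : (z <= 1)%R by rewrite invf_le1 // ler1n.
pose a : R := (\sum_(o <- ops) z ^+ o.2)%R.
(* A strict inequality of integers gains 1, which is b^-C after division by b^C. *)
have aC : (1 + (b ^ C)%:R^-1 <= a)%R.
  have bC0 : (0 < (b ^ C)%:R :> R)%R by rewrite ltr0n expn_gt0 b0.
  rewrite -(ler_pM2r bC0) mulrDl mulVf ?gt_eqF // mul1r natr1.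
  have -> : (a * (b ^ C)%:R = (\sum_(o <- ops) b ^ (C - o.2))%:R)%R.
    rewrite natr_sum mulr_suml; apply: eq_big_seq => o /ok/andP[_ oC].
    rewrite !natrX -{1}(subnKC oC) exprD mulrA -exprMn mulVf ?gt_eqF //.
    by rewrite expr1n mul1r.
  by rewrite ler_nat.
have aD := weight_growth b1 j0 jD aC.
pose c := 13 + j * ((13 + l0) %/ D).+1 + 2 * D.
pose k : R := (z ^+ (c + l0))%R.
have k0 : (0 < k)%R by rewrite exprn_gt0.
pose r := Num.Def.archi_bound (`|A| / k)%R.
have rA : (A <= k * r%:R)%R.
  rewrite mulrC -ler_pdivrMr //.
  have /archi_boundP/ltW : (0 <= `|A| / k)%R by rewrite divr_ge0 // ltW.
  apply: le_trans; rewrite ler_pM2r ?invr_gt0 //; exact: ler_norm.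
exists [seq (w.1, window_length j D w.2) | w <- iterates ops (v0, l0) (r * D)].
split.
- by rewrite -map_comp; exact: uni.
- move=> _ /mapP[w win ->] /=; have [v0w lw lC] := bnd _ _ win; split.
    apply: leq_trans (window_length_linear _ _ _) _.
    apply: (@leq_trans (c1 * w.1)).
      have -> : c1 = (13 + 14 * j + 2 * D) + j.+1 by rewrite /c1; lia.
      rewrite mulnDl leq_add ?leq_mul // leq_pmulr //.
      exact: leq_trans v0w.
    apply: leq_trans (mul_le_exp2 (leq_trans c1v0 v0w)) _.
    by rewrite leq_exp2r //; lia.
  move=> x V x0 Vlt; apply: nice_of_window => //; first exact: repr win.
  exact: representable_gap.
- apply: le_trans rA _; rewrite big_map /=.
  (* Every window length is replaced by its upper bound; this lowers the sum because z <= 1. *)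
  apply: (@le_trans _ _ (\sum_(w <- iterates ops (v0, l0) (r * D))
     z ^+ w.2 * (z ^+ c * z ^+ (r * (j * C))))%R); last first.
    rewrite big_seq [leRHS]big_seq; apply: ler_sum => w win.
    have [_ _ lC] := bnd _ _ win.
    rewrite -!exprD addnA; apply: ler_wiXn2l; rewrite ?(ltW z0) //.
    exact: window_length_le.
  rewrite -mulr_suml iterates_weight /= -/a.
  have -> : (a ^+ (r * D) * z ^+ l0 * (z ^+ c * z ^+ (r * (j * C))) =
            k * (a ^+ D * z ^+ (j * C)) ^+ r)%R.
    by rewrite exprMn -!exprM (mulnC D) (mulnC _ r) /k exprD; ring.
  rewrite ler_pM2l //; apply: (@le_trans _ _ (2 ^+ r)%R).
    by rewrite -natrX ler_nat ltnW // ltn_expl.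
  rewrite lerXn2r ?nnegrE //.
    by rewrite mulr_ge0 ?exprn_ge0 // ?(ltW z0)// (le_trans _ aC).
  rewrite /z exprVn -natrX ler_pdivlMr //.
  by rewrite ltr0n expn_gt0 b0.
Qed.

(** * Density *)

Lemma sum_nat_divmod (F : nat -> nat -> nat) (q n : nat) : 0 < n ->
  \sum_(0 <= m < q * n) F (m %/ n) (m %% n) =
  \sum_(0 <= i < q) \sum_(0 <= r < n) F i r.
Proof.
move=> n0; elim: q => [|q IHq]; first by rewrite mul0n !big_geq.
rewrite big_nat_recr //= -IHq mulSn addnC (@big_cat_nat _ _ _ (q * n)) ?leq_addr //=.
congr (_ + _); rewrite -{1}[q * n]add0n big_addn addnC addnK.
apply: eq_big_nat => r /andP[_ rn].
by rewrite addnC divnMDl // divn_small // addn0 modnMDl modn_small.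
Qed.

Lemma sum_nat_periodic (F : nat -> nat) (q n : nat) : 0 < n ->
  \sum_(0 <= m < q * n) F (m %% n) = q * \sum_(0 <= r < n) F r.
Proof.
move=> n0; rewrite (@sum_nat_divmod (fun _ => F)) // sum_nat_const_nat.
by rewrite subn0.
Qed.

Definition avoids (b : nat) (s : seq (nat * nat)) (m : nat) : bool :=
  all (fun w => (m %/ b ^ (b ^ w.1)) %% b ^ w.2 != b ^ w.2 - 1) s.

Definition windows_below (u : nat) (s : seq (nat * nat)) : seq (nat * nat) :=
  [seq w <- s | w.1 < u].

(** A window at v < u ends no later than position 2 b^v <= b^(v+1) <= b^u, so only the lowest b^u
    digits matter. *)
Lemma avoids_modn (b u m : nat) (s : seq (nat * nat)) : 1 < b ->
  (forall w : nat * nat, w \in s -> w.2 <= b ^ w.1) ->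
  avoids b (windows_below u s) (m %% b ^ (b ^ u)) =
  avoids b (windows_below u s) m.
Proof.
move=> b1 sL; apply: eq_in_all => -[v l]; rewrite mem_filter => /andP[/= vu vls].
have b0 : 0 < b by exact: ltnW.
rewrite !modn_divl modn_dvdm // -expnD dvdn_exp2l //.
apply: (@leq_trans (b ^ v.+1)); last by rewrite leq_exp2l.
have /= := sL _ vls; rewrite expnS.
have : 2 * b ^ v <= b * b ^ v by rewrite leq_mul2r b1 orbT.
lia.
Qed.

(** Positions are distinct, so raising the bound by one adds at most one window. *)
Lemma windows_belowS (u : nat) (s : seq (nat * nat)) :
  uniq [seq w.1 | w <- s] ->
  windows_below u.+1 s = windows_below u s \/
  exists2 w : nat * nat, w \in s & w.1 = u /\
    perm_eq (windows_below u.+1 s) (w :: windows_below u s).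
Proof.
move=> us.
have pe : perm_eq ([seq w <- s | w.1 == u] ++ windows_below u s)
                  (windows_below u.+1 s).
  have /permEl := perm_filterC (fun w => w.1 == u) (windows_below u.+1 s).
  rewrite /windows_below -!filter_predI.
  rewrite (@eq_filter _ _ (fun w => w.1 == u)); last by move=> -[v l] /=; lia.
  by rewrite (@eq_filter _ (predI (predC _) _) (fun w => w.1 < u)) // => -[v l] /=; lia.
have : size [seq w <- s | w.1 == u] <= 1.
  rewrite size_filter.
  have -> : count (fun w => w.1 == u) s = count_mem u [seq w.1 | w <- s].
    by rewrite count_map.
  by rewrite count_uniq_mem //; case: (_ \in _).
case E : [seq w <- s | w.1 == u] pe => [|w [|//]] pe _; [left|right].
  apply: eq_in_filter => -[v l] vls.
  have : (v, l) \notin [seq w <- s | w.1 == u] by rewrite E.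
  by rewrite mem_filter vls andbT /=; lia.
have : w \in [seq w <- s | w.1 == u] by rewrite E mem_head.
rewrite mem_filter => /andP[/eqP wu ws].
by exists w => //; split => //; rewrite perm_sym.
Qed.

(** The window at u lies above the lowest b^u digits and all others lie within them, so the count
    factors; of the b^L patterns in that window one is excluded. *)
Lemma sum_avoids_recr (b u : nat) (s : seq (nat * nat)) (w : nat * nat) :
  1 < b -> (forall w : nat * nat, w \in s -> w.2 <= b ^ w.1) -> w \in s -> w.1 = u ->
  \sum_(0 <= m < b ^ (b ^ u.+1)) avoids b (w :: windows_below u s) m =
  b ^ (b ^ u.+1 - b ^ u - w.2) * (b ^ w.2 - 1) *
  \sum_(0 <= m < b ^ (b ^ u)) avoids b (windows_below u s) m.
Proof.
move=> b1 sL ws wu; have b0 : 0 < b by exact: ltnW.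
have P0 : 0 < b ^ (b ^ u) by rewrite expn_gt0 b0.
have Q0 : 0 < b ^ w.2 by rewrite expn_gt0 b0.
have PE : b ^ (b ^ u.+1) =
    b ^ (b ^ u.+1 - b ^ u - w.2) * b ^ w.2 * b ^ (b ^ u).
  rewrite -!expnD; congr (_ ^ _).
  have := sL _ ws; rewrite wu expnS => h.
  have : 2 * b ^ u <= b * b ^ u by rewrite leq_mul2r b1 orbT.
  lia.
set q := b ^ (_ - _) in PE *; set P := b ^ (b ^ u) in P0 PE *.
set Q := b ^ w.2 in Q0 PE *.
pose F i r := (i %% Q != Q - 1) * avoids b (windows_below u s) r.
rewrite PE (eq_bigr (fun m => F (m %/ P) (m %% P))); last first.
  by move=> m _; rewrite /F /P avoids_modn // -mulnb /= wu.
rewrite sum_nat_divmod // /F.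
under eq_bigr do rewrite -big_distrr /=.
rewrite -big_distrl /=; congr (_ * _).
rewrite (@sum_nat_periodic (fun i => i != Q - 1)) //; congr (_ * _).
rewrite -{1}(subnK Q0) addn1 big_nat_recr //= eqxx addn0.
rewrite (eq_big_nat _ _ (F2 := fun=> 1)) ?sum_nat_const_nat ?subn0 ?muln1 //.
by move=> i /andP[_ iQ]; rewrite (ltn_eqF iQ).
Qed.

(* 1 - t <= 1 / (1 + t) and the product of the (1 + t_i) is at least
   1 + sum t_i, so independence of disjoint windows gives this bound. *)
Lemma avoids_density (R : realFieldType) (b u : nat) (s : seq (nat * nat)) :
  1 < b -> (forall w : nat * nat, w \in s -> w.2 <= b ^ w.1) ->
  uniq [seq w.1 | w <- s] ->
  ((\sum_(0 <= m < b ^ (b ^ u)) avoids b (windows_below u s) m)%:R *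
   (1 + \sum_(w <- windows_below u s) b%:R^-1 ^+ w.2) <=
   (b ^ (b ^ u))%:R :> R)%R.
Proof.
move=> b1 sL us; have b0 : 0 < b by exact: ltnW.
have T0 v : (0 <= \sum_(w <- windows_below v s) b%:R^-1 ^+ w.2 :> R)%R.
  by apply: sumr_ge0 => w _; rewrite exprn_ge0 // invr_ge0.
elim: u => [|u IHu].
  rewrite /windows_below (@eq_filter _ _ pred0) // filter_pred0 big_nil addr0.
  rewrite mulr1 ler_nat /avoids /=.
  by rewrite (eq_bigr (fun=> 1)) // sum_nat_const_nat subn0 muln1.
have P0 : 0 < b ^ (b ^ u) by rewrite expn_gt0 b0.
have [E|[w ws [wu pe]]] := windows_belowS u us.
  rewrite E.
  have PE : b ^ (b ^ u.+1) = b ^ (b ^ u.+1 - b ^ u) * b ^ (b ^ u).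
    by rewrite -expnD subnK // leq_exp2l.
  rewrite PE; under eq_bigr do rewrite -avoids_modn //.
  rewrite (@sum_nat_periodic (fun m => avoids b (windows_below u s) m)) //.
  by rewrite !natrM -mulrA ler_wpM2l.
rewrite (perm_big _ pe) big_cons.
under eq_bigr do rewrite /avoids (perm_all _ pe) -/(avoids _ _ _).
rewrite sum_avoids_recr //.
set N := (\sum_(0 <= m < _) _) in IHu *; set q := b ^ (_ - _).
have PE : b ^ (b ^ u.+1) = q * b ^ w.2 * b ^ (b ^ u).
  rewrite -!expnD; congr (_ ^ _).
  have := sL _ ws; rewrite wu expnS => h.
  have : 2 * b ^ u <= b * b ^ u by rewrite leq_mul2r b1 orbT.
  lia.
have Q0 : 0 < b ^ w.2 by rewrite expn_gt0 b0.
rewrite PE exprVn -natrX !natrM -!mulrA ler_wpM2l // natrB //.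
have := T0 u; move: IHu; set T := (\sum_(_ <- _) _)%R.
have n0 : (0 <= N%:R :> R)%R by [].
have Q1 : (1 <= (b ^ w.2)%:R :> R)%R by rewrite ler1n.
move: n0 Q1; move: (b ^ w.2)%:R%R N%:R%R (b ^ (b ^ u))%:R%R => Q n P n0 Q1 IHu T00.
have Qgt : (0 < Q)%R by lra.
(* The induction hypothesis reduces the claim to (Q - 1)(1 + 1/Q + T) <= Q(1 + T), whose sides
   differ by T + 1/Q. *)
apply: (@le_trans _ _ (Q * (n * (1 + T)))%R); last by rewrite ler_wpM2l // ltW.
rewrite mulrCA [leRHS]mulrCA ler_wpM2l //.
have -> : ((Q - 1) * (1 + (Q^-1 + T)) = Q * (1 + T) - (T + Q^-1))%R.
  by field; rewrite gt_eqF.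
rewrite gerBl addr_ge0 // invr_ge0; lra.
Qed.

(** The lower bound on m makes the part x above the run positive; the run turns x b^L + (b^L - 1)
    into (x + 1) b^L - 1. *)
Lemma nice_window_hit (R : realType) (b u L m : nat) : 1 < b ->
  nice_window R b u L -> b ^ (b ^ u) * b ^ L <= m ->
  (m %/ b ^ (b ^ u)) %% b ^ L = b ^ L - 1 -> nice_friedman R b m.
Proof.
move=> b1 win mge hit; have b0 : 0 < b by exact: ltnW.
have P0 : 0 < b ^ (b ^ u) by rewrite expn_gt0 b0.
have Q0 : 0 < b ^ L by rewrite expn_gt0 b0.
have mE := divn_eq m (b ^ (b ^ u)).
have mE' := divn_eq (m %/ b ^ (b ^ u)) (b ^ L).
rewrite hit in mE'.
rewrite mE mE' addnBA // [_ + b ^ L]addnC -mulSn.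
apply: win; last by rewrite ltn_mod.
by rewrite -divnMA divn_gt0 // muln_gt0 P0.
Qed.

Lemma avoids_of_not_nice (R : realType) (b u m : nat) (s : seq (nat * nat)) :
  1 < b -> (forall w : nat * nat, w \in s -> w.2 <= b ^ w.1) ->
  (forall w : nat * nat, w \in s -> nice_window R b w.1 w.2) ->
  b ^ (b ^ u) <= m -> ~ nice_friedman R b m ->
  avoids b (windows_below u s) m.
Proof.
move=> b1 sL snice mge nn; apply/allP => -[v l].
rewrite mem_filter => /andP[/= vu vls]; apply/negP => /eqP hit; apply: nn.
apply: (nice_window_hit b1 (snice _ vls) _ hit) => /=.
apply: leq_trans mge; rewrite -expnD leq_exp2l //.
apply: (@leq_trans (b ^ v.+1)); last by rewrite leq_exp2l.
have /= := sL _ vls; rewrite expnS.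
have : 2 * b ^ v <= b * b ^ v by rewrite leq_mul2r b1 orbT.
lia.
Qed.

(** Every m up to n is nice, or below b^(b^u), or avoids all windows. Avoidance has period b^(b^u),
    so it is counted over full periods covering n. *)
Lemma nice_count_ge (R : realType) (b u n : nat) (s : seq (nat * nat)) :
  1 < b -> (forall w : nat * nat, w \in s -> w.2 <= b ^ w.1) ->
  (forall w : nat * nat, w \in s -> nice_window R b w.1 w.2) ->
  n <= nice_count R b n + b ^ (b ^ u) + (n %/ b ^ (b ^ u)).+1 *
    \sum_(0 <= m < b ^ (b ^ u)) avoids b (windows_below u s) m.
Proof.
move=> b1 sL snice; set P := b ^ (b ^ u).
have P0 : 0 < P by rewrite expn_gt0 ltnW.
rewrite -(@sum_nat_periodic (fun m => avoids b (windows_below u s) m)) //.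
set q := (n %/ P).+1; have nq : n < q * P by rewrite -ltn_divLR.
under [X in _ <= _ + X]eq_bigr do rewrite avoids_modn //.
have PE : P = \sum_(0 <= m < q * P) (m < P).
  rewrite (@big_cat_nat _ _ _ P) //=; last by rewrite leq_pmull.
  rewrite [X in _ + X]big1_seq ?addn0; last first.
    by move=> i /=; rewrite mem_index_iota => /andP[Pi _]; rewrite ltnNge Pi.
  rewrite (eq_big_nat _ _ (F2 := fun=> 1)) ?sum_nat_const_nat ?subn0 ?muln1 //.
  by move=> i /andP[_ ->].
rewrite {1}PE -addnA -big_split /=.
have -> : nice_count R b n = \sum_(1 <= m < n.+1) `[< nice_friedman R b m >].
  by rewrite /nice_count big_mkcond; apply: eq_bigr => m _; case: asbool.
have nE : n = \sum_(1 <= m < n.+1) 1 by rewrite sum_nat_const_nat muln1 subn1.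
rewrite {1}nE; apply: (@leq_trans (\sum_(1 <= m < n.+1)
  (`[< nice_friedman R b m >] + ((m < P) + avoids b (windows_below u s) m)))).
  apply: leq_sum => m _; case: asboolP => //= nn.
  case: (ltnP m P) => //= mP.
  by rewrite (avoids_of_not_nice b1 sL snice mP nn).
(* The range [1, n] is enlarged to whole periods by adding m = 0 and the terms beyond n. *)
rewrite big_split leq_add2l /= [leqRHS](@big_cat_nat _ _ _ n.+1) //=.
rewrite [in leqRHS]big_ltn // -addnA; apply: leq_trans (leq_addl _ _).
exact: leq_addr.
Qed.

(** With P = b^(b^u), the factor 2 collects one P for the numbers below P and at most one more for
    the incomplete last period. *)
Lemma nice_count_ratio_ge (R : realType) (b u n : nat) (s : seq (nat * nat)) :
  1 < b -> 0 < n -> uniq [seq w.1 | w <- s] ->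
  (forall w : nat * nat, w \in s -> w.1 < u) ->
  (forall w : nat * nat, w \in s -> w.2 <= b ^ w.1) ->
  (forall w : nat * nat, w \in s -> nice_window R b w.1 w.2) ->
  (1 - (1 + \sum_(w <- s) b%:R^-1 ^+ w.2)^-1 - 2 * (b ^ (b ^ u))%:R / n%:R
    <= (nice_count R b n)%:R / n%:R :> R)%R.
Proof.
move=> b1 n0 us su sL snice.
have sE : windows_below u s = s by apply/all_filterP/allP => w /su.
have := avoids_density R u b1 sL us; have := nice_count_ge u n b1 sL snice.
rewrite sE; set P := b ^ (b ^ u); set N := \sum_(0 <= m < P) _; set T := (\sum_(_ <- _) _)%R.
have T0 : (0 <= T)%R by apply: sumr_ge0 => w _; rewrite exprn_ge0 // invr_ge0.
have P0 : 0 < P by rewrite expn_gt0 ltnW.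
have T1 : (0 < 1 + T)%R by lra.
have nR : (0 < n%:R :> R)%R by rewrite ltr0n.
move=> cnt; rewrite -ler_pdivlMr // => NP.
have dn : (n %/ P).+1 * P <= n + P by rewrite mulSn addnC leq_add2r leq_trunc_div.
move: cnt dn; move: (n %/ P).+1 => k.
rewrite -(ler_nat R) -(ler_nat R (_ * P)) !natrD !natrM.
have q0 : (0 <= k%:R :> R)%R by [].
have i1 : (0 < (1 + T)^-1 <= 1)%R by rewrite invr_gt0 T1 invf_le1 //; lra.
have PR : (0 <= P%:R :> R)%R by [].
rewrite lerBlDr -mulrDl ler_pdivlMr //.
move: (nice_count R b n)%:R%R (n%:R)%R (P%:R)%R (N%:R)%R (k%:R)%R
  (1 + T)^-1%R nR PR NP q0 i1.
move=> F x p N' q i nR PR NP q0 /andP[i0 i1] cnt dn.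
have : (q * N' <= (q * p) * i)%R by rewrite -mulrA ler_wpM2l.
have : ((q * p) * i <= (x + p) * i)%R by rewrite ler_wpM2r // ltW.
have : (p * i <= p)%R by rewrite ler_piMr.
nra.
Qed.

Local Open Scope classical_set_scope.
Local Open Scope ring_scope.

Lemma nice_density_cvg (R : realType) (b : nat) : (1 < b)%N ->
  (forall A : R, exists s : seq (nat * nat),
    [/\ uniq [seq w.1 | w <- s],
        forall w : nat * nat, w \in s ->
          (w.2 <= b ^ w.1)%N /\ nice_window R b w.1 w.2
      & A <= \sum_(w <- s) b%:R^-1 ^+ w.2]) ->
  (fun n : nat => (nice_count R b n)%:R / n%:R : R) @ \oo --> (1 : R).
Proof.
move=> b1 H; apply/cvgrPdist_le => e e0.
(* Total weight 2 / e makes the avoiding density at most e / 2; the boundary term takes the other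
   half for large n. *)
have [s [us sP sA]] := H (2 / e).
pose u := (\max_(w <- s) w.1).+1.
have su (w : nat * nat) : w \in s -> (w.1 < u)%N.
  by move=> ws; rewrite ltnS (big_rem w) //= leq_maxl.
near=> n.
have n0 : (0 < n)%N by near: n; exact: nbhs_infty_gt.
have nR : (0 < n%:R :> R) by rewrite ltr0n.
have := nice_count_ratio_ge b1 n0 us su (fun w h => (sP w h).1) (fun w h => (sP w h).2).
have le1 : (nice_count R b n)%:R / n%:R <= 1 :> R.
  rewrite ler_pdivrMr // mul1r ler_nat /nice_count big_mkcond /=.
  have nE : n = (\sum_(1 <= m < n.+1) 1)%N by rewrite sum_nat_const_nat muln1 subn1.
  by rewrite {2}nE; apply: leq_sum => m _; case: ifP.
have large : 2 * (b ^ (b ^ u))%:R / n%:R <= e / 2.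
  rewrite ler_pdivrMr // -ler_pdivrMl ?divr_gt0 //.
  by near: n; exact: nbhs_infty_ger.
have small : (1 + \sum_(w <- s) b%:R^-1 ^+ w.2)^-1 <= e / 2.
  rewrite -[leRHS]invrK lef_pV2 ?posrE ?invr_gt0 ?divr_gt0 //.
    by rewrite invf_div (le_trans sA) // lerDr.
  have A0 : 0 < 2 / e by rewrite divr_gt0.
  by rewrite (lt_le_trans A0) // (le_trans sA) // lerDr.
rewrite ger0_norm ?subr_ge0 //; lra.
Unshelve. all: by end_near.
Qed.

(** * Bases 2, 3 and 4 *)

Local Open Scope nat_scope.

(** The zero shift stands for y^v alone and costs no digit. *)
Definition signed_shifts (cs : seq (nat * nat)) : seq (nat * nat * nat) :=
  ((0, 0), 0) ::
  [seq ((c.1, 0), c.2) | c <- cs] ++ [seq ((0, c.1), c.2) | c <- cs].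

Definition power_ops (ys cs : seq (nat * nat)) : seq (nat * (nat * nat) * nat) :=
  [seq ((y.1, t.1), y.2 + t.2) | y <- ys, t <- signed_shifts cs].

Lemma power_ops_representable (R : realType) (b p K : nat)
    (ys cs : seq (nat * nat)) :
  (forall y : nat * nat, y \in ys -> representable R b y.2 y.1) ->
  (forall c : nat * nat, c \in cs -> representable R b c.2 c.1) ->
  all (fun o => admissible_op p K o.1) (power_ops ys cs) ->
  forall o l v, o \in power_ops ys cs -> K <= v -> representable R b l v ->
    representable R b (o.2 + l) (shift_pow o.1 v).
Proof.
move=> rys rcs /allP adm o l v oin Kv rv.
have aO := adm _ oin; have sle := admissible_op_shift_le aO Kv.
case/allpairsP: oin aO sle => -[y t] [/= yin tin ->] /= aO sle.
have y0 : 0 < y.1 by case/andP: aO => /= h _; exact: ltnW.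
have ryv := representableX y0 (rys _ yin) rv.
rewrite /shift_pow /= addnAC.
move: tin sle; rewrite inE mem_cat.
case/orP=> [/eqP-> _ /=|/orP[]/mapP[c cin ->] /= sle]; rewrite ?addn0 ?subn0 //.
- by apply: representableD => //; apply: rcs.
- by apply: representableB => //; apply: rcs.
Qed.

(** Reduces a base to finite data: the boolean condition is decided by computation. *)
Lemma nice_density_of_ops (R : realType) (b p K C : nat)
    (ys cs : seq (nat * nat)) :
  1 < b -> 0 < K ->
  (forall y : nat * nat, y \in ys -> representable R b y.2 y.1) ->
  (forall c : nat * nat, c \in cs -> representable R b c.2 c.1) ->
  let ops := power_ops ys cs in
  [&& uniq [seq o.1 | o <- ops],
      all (fun o => admissible_op p K o.1 && (o.2 <= C)) ops
    & b ^ C < sumn [seq b ^ (C - o.2) | o <- ops]] ->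
  ((fun n : nat => (nice_count R b n)%:R / n%:R : R) @ \oo --> (1 : R))%classic%R.
Proof.
move=> b1 K0 rys rcs ops /and3P[uops aops wt].
apply: nice_density_cvg => // A.
apply: (nice_windows A b1 K0 uops aops); last by rewrite sumnE big_map in wt.
apply: (power_ops_representable rys rcs (p := p)).
by apply: sub_all aops => o /andP[].
Qed.

Lemma nice_density2 (R : realType) :
  ((fun n : nat => (nice_count R 2 n)%:R / n%:R : R) @ \oo --> (1 : R))%classic%R.
Proof.
have r1 : representable R 2 1 1 by exact: representable_digit.
have r2 : representable R 2 2 2 := representableD r1 r1.
have r3 : representable R 2 2 3 by exact: (@representable_block _ 2 2).
have r6 : representable R 2 4 6 := representableD r3 r3.
have r15 : representable R 2 4 15 by exact: (@representable_block _ 2 4).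
(* The total weight is 3/8 * 3 = 9/8, powers times shifts; [K] = 2 since 2 * 3 < 3^2. *)
apply: (@nice_density_of_ops R 2 3 2 6
  [:: (3, 2); (6, 4); (15, 4)]
  [:: (1, 1); (2, 2); (3, 2)] isT isT).
- by move=> y; do ![rewrite in_cons => /predU1P[-> //|]].
- by move=> y; do ![rewrite in_cons => /predU1P[-> //|]].
- by vm_compute.
Qed.

Lemma nice_density3 (R : realType) :
  ((fun n : nat => (nice_count R 3 n)%:R / n%:R : R) @ \oo --> (1 : R))%classic%R.
Proof.
have r2 : representable R 3 1 2 by exact: representable_digit.
have r1 : representable R 3 2 1 by exact: representable1.
have r8 : representable R 3 2 8 by exact: (@representable_block _ 3 2).
have r26 : representable R 3 3 26 by exact: (@representable_block _ 3 3).
have r4 : representable R 3 2 4 := representableD r2 r2.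
have r3 : representable R 3 3 3 := representableD r2 r1.
have r6 : representable R 3 3 6 := representableD r2 r4.
have r10 : representable R 3 3 10 := representableD r2 r8.
(* The total weight is 4/9 * 67/27 = 268/243; [K] = 5 since 2 * 8 < 2^5. *)
apply: (@nice_density_of_ops R 3 2 5 6
  [:: (2, 1); (6, 3); (10, 3); (26, 3)]
  [:: (2, 1); (1, 2); (4, 2); (8, 2); (3, 3); (6, 3)] isT isT).
- by move=> y; do ![rewrite in_cons => /predU1P[-> //|]].
- by move=> y; do ![rewrite in_cons => /predU1P[-> //|]].
- by vm_compute.
Qed.

Lemma nice_density4 (R : realType) :
  ((fun n : nat => (nice_count R 4 n)%:R / n%:R : R) @ \oo --> (1 : R))%classic%R.
Proof.
have r3 : representable R 4 1 3 by exact: representable_digit.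
have r1 : representable R 4 2 1 by exact: representable1.
have r15 : representable R 4 2 15 by exact: (@representable_block _ 4 2).
have r6 : representable R 4 2 6 := representableD r3 r3.
have r9 : representable R 4 2 9 := representableM r3 r3.
have r27 : representable R 4 2 27 := representableX (isT : 0 < 3) r3 r3.
have r2 : representable R 4 3 2 := representableB (isT : 1 <= 3) r3 r1.
have r4 : representable R 4 3 4 := representableD r3 r1.
have r5 : representable R 4 3 5 := 
  representable_div (isT : 0 < 3) (isT : 3 %| 15) r15 r3.
have r12 : representable R 4 3 12 := representableB (isT : 3 <= 15) r15 r3.
have r18 : representable R 4 3 18 := representableD r15 r3.
have r24 : representable R 4 3 24 := representableB (isT : 3 <= 27) r27 r3.
have r30 : representable R 4 3 30 := representableD r27 r3.
have r45 : representable R 4 3 45 := representableM r15 r3.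
have r63 : representable R 4 3 63 by exact: (@representable_block _ 4 3).
have r81 : representable R 4 3 81 := representableM r27 r3.
have r216 : representable R 4 3 216 := representableX (isT : 0 < 6) r6 r3.
(* The total weight is 27/64 * 158/64 = 4266/4096, barely above 1, hence the long list of shifts;
   [K] = 6 since 2 * 216 < 3^6. *)
apply: (@nice_density_of_ops R 4 3 6 6
  [:: (3, 1); (6, 2); (15, 2); (12, 3); (24, 3); (30, 3)]
  [:: (3, 1); (1, 2); (6, 2); (9, 2); (15, 2); (27, 2);
      (2, 3); (4, 3); (5, 3); (12, 3); (18, 3); (24, 3); (30, 3); (45, 3);
      (63, 3); (81, 3); (216, 3)] isT isT).
- by move=> y; do ![rewrite in_cons => /predU1P[-> //|]].
- by move=> y; do ![rewrite in_cons => /predU1P[-> //|]].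
- by vm_compute.
Qed.

Local Open Scope classical_set_scope.
Local Open Scope ring_scope.

Theorem theorem2 (R : realType) (b : nat) (hb : b \in [:: 2; 3; 4]%N) :
  (fun n : nat => (nice_count R b n)%:R / n%:R : R) @ \oo --> (1 : R).
Proof.
move: hb; rewrite !inE => /or3P[] /eqP->.
- exact: nice_density2.
- exact: nice_density3.
- exact: nice_density4.
Qed.
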